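(* For any given $\epsilon>0$, the approximate column-generation algorithm described in the context generates an $\epsilon$-optimal solution of the CDLP; that is, the solution it outputs (the optimal solution of the reduced linear program at termination, extended by $x_k(S)=0$ for assortments $S$ outside the final active set) is feasible for the CDLP and has objective value at least $(1-\epsilon)V^{CDLP}$.
   Context: **Data.** There are $L$ resources with capacities $C_l$, $N$ products, and $K$ customer types with expected arrival numbers $\Lambda_k\ge0$. Product $n\in\{1,\dots,N\}$ uses resource $l_n$ and has reward $r_n$; $N_l=\{n:l_n=l\}$; product $0$ is the no-purchase option with $r_0=0$. $\mathcal S$ is the set of all assortments (subsets of $\{0,\dots,N\}$ containing $0$). $P^k(n,S)$ is the probability that a type-$k$ customer offered $S$ chooses $n\in S$, with $\sum_{n\in S}P^k(n,S)=1$ (arbitrary choice model). **CDLP.** $$V^{CDLP}=\max_x\ \sum_{k=1}^K\sum_{S\in\mathcal S}\Lambda_kx_k(S)\sum_{n\in S}P^k(n,S)r_n$$ subject to (i) $\sum_{k}\Lambda_k\sum_{n\in N_j}\sum_{S\in\mathcal S:n\in S}x_k(S)P^k(n,S)\le C_j$ for $j=1,\dots,L$; (ii) $\sum_{S\in\mathcal S}x_k(S)\le1$ for $k=1,\dots,K$; (iii) $x_k(S)\ge0$. A feasible solution $x$ is *$\epsilon$-optimal* if $\sum_{k}\sum_{S}\Lambda_kx_k(S)\sum_{n\in S}r_nP^k(n,S)\ge(1-\epsilon)V^{CDLP}$. **Algorithm.** Start with any collection $\mathcal H^1\subseteq\mathcal S$ and $d=1$. In iteration $d$: 1. Solve the reduced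 LP, i.e. the CDLP with $\mathcal S$ replaced by $\mathcal H^d$ everywhere, obtaining an optimal primal solution and optimal dual variables $\pi(1),\dots,\pi(L)\ge0$ (capacity constraints (i)) and $\sigma(1),\dots,\sigma(K)\ge0$ (constraints (ii)). 2. For each $k$, let $S_k^*(\pi)\in\arg\max_{S\in\mathcal S}\sum_{n\in S,n>0}P^k(n,S)[r_n-\pi(l_n)]$, and find (using an approximation scheme) an assortment $S_k^d$ satisfying $$\sum_{n\in S_k^d,n>0}P^k(n,S_k^d)[r_n-\pi(l_n)]\ \ge\ \Big(1-\frac{\epsilon}{1+\epsilon}\Big)\sum_{n\in S_k^*(\pi),n>0}P^k(n,S_k^*(\pi))[r_n-\pi(l_n)].$$ 3. If $\Lambda_k\sum_{n\in S_k^d,n>0}[r_n-\pi(l_n)]P^k(n,S_k^d)-\sigma(k)\le0$ for every $k$, stop and output the optimal solution of the current reduced LP. Otherwise, let $k^*$ maximize the left-hand side over $k$, set $\mathcal H^{d+1}=\mathcal H^d\cup\{S^d_{k^*}\}$, increase $d$ by one and repeat. *)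

(* Defs.v *)
From HB Require Import structures.
From mathcomp Require Import all_boot all_order all_algebra.

Set Implicit Arguments.
Unset Strict Implicit.
Unset Printing Implicit Defensive.

Import Order.TTheory GRing.Theory Num.Theory.
Local Open Scope ring_scope.

(* The scalars are any [R : realFieldType], of which the real numbers are an
   instance. *)

(* Products 1, ..., N are the elements of ['I_N]; the options 0, 1, ..., N are
   the elements of [option 'I_N], [None] being product 0 (no purchase). *)
Definition assortments (N : nat) : {set {set option 'I_N}} :=
  [set S : {set option 'I_N} | None \in S].

(* [choice_prob k n S] is P^k(n,S). It is only meaningful for [n \in S] and
   [S \in assortments N], so nothing is assumed about its other values, and
   they are never used. *)
Record network (R : realFieldType) (L N K : nat) := Network {
  capacity : 'I_L -> R;
  arrival : 'I_K -> R;
  resource : 'I_N -> 'I_L;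
  reward : 'I_N -> R;
  choice_prob : 'I_K -> option 'I_N -> {set option 'I_N} -> R;
  arrival_ge0 : forall k, 0 <= arrival k;
  choice_prob_ge0 : forall k n S,
    S \in assortments N -> n \in S -> 0 <= choice_prob k n S;
  choice_prob_sum1 : forall k S,
    S \in assortments N -> \sum_(n in S) choice_prob k n S = 1
}.

(* The reward r_n for n = 0, ..., N, with r_0 = 0. *)
Definition reward0 (R : realFieldType) (L N K : nat) (D : network R L N K)
    (n : option 'I_N) : R :=
  oapp (reward D) 0 n.

(* The linear program over a collection [H] of assortments: the CDLP is the
   case [H = assortments N], the reduced programs have [H] a subset of it.
   The variables are the [x k S] with [S \in H]; other values are ignored. *)
Definition primal_objective (R : realFieldType) (L N K : nat)
    (D : network R L N K) (H : {set {set option 'I_N}})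
    (x : 'I_K -> {set option 'I_N} -> R) : R :=
  \sum_(k < K) \sum_(S in H)
     arrival D k * x k S * (\sum_(n in S) choice_prob D k n S * reward0 D n).

Definition primal_feasible (R : realFieldType) (L N K : nat)
    (D : network R L N K) (H : {set {set option 'I_N}})
    (x : 'I_K -> {set option 'I_N} -> R) : Prop :=
  [/\ forall j : 'I_L,
        \sum_(k < K) arrival D k *
          (\sum_(n < N | resource D n == j)
             \sum_(S in H | Some n \in S) x k S * choice_prob D k (Some n) S)
        <= capacity D j,
      forall k : 'I_K, \sum_(S in H) x k S <= 1
    & forall (k : 'I_K) (S : {set option 'I_N}), S \in H -> 0 <= x k S].

Definition primal_optimal (R : realFieldType) (L N K : nat)
    (D : network R L N K) (H : {set {set option 'I_N}})
    (x : 'I_K -> {set option 'I_N} -> R) : Prop :=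
  primal_feasible D H x /\
  forall y, primal_feasible D H y ->
    primal_objective D H y <= primal_objective D H x.

(* The LP dual of the program above: [pi j] prices the capacity constraint of
   resource j, [sigma k] the constraint \sum_S x k S <= 1, and there is one
   dual constraint for each primal variable [x k S]. *)
Definition dual_objective (R : realFieldType) (L N K : nat)
    (D : network R L N K) (pi : 'I_L -> R) (sigma : 'I_K -> R) : R :=
  \sum_(j < L) capacity D j * pi j + \sum_(k < K) sigma k.

Definition dual_feasible (R : realFieldType) (L N K : nat)
    (D : network R L N K) (H : {set {set option 'I_N}})
    (pi : 'I_L -> R) (sigma : 'I_K -> R) : Prop :=
  [/\ forall j : 'I_L, 0 <= pi j,
      forall k : 'I_K, 0 <= sigma k
    & forall (k : 'I_K) (S : {set option 'I_N}), S \in H ->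
        arrival D k * (\sum_(n in S) choice_prob D k n S * reward0 D n)
        <= \sum_(j < L)
             (arrival D k *
                (\sum_(n < N | (resource D n == j) && (Some n \in S))
                   choice_prob D k (Some n) S)) * pi j
           + sigma k].

Definition dual_optimal (R : realFieldType) (L N K : nat)
    (D : network R L N K) (H : {set {set option 'I_N}})
    (pi : 'I_L -> R) (sigma : 'I_K -> R) : Prop :=
  dual_feasible D H pi sigma /\
  forall pi' sigma', dual_feasible D H pi' sigma' ->
    dual_objective D pi sigma <= dual_objective D pi' sigma'.

(* [V] is the maximum V^CDLP (attained, hence unique). *)
Definition is_cdlp_value (R : realFieldType) (L N K : nat)
    (D : network R L N K) (V : R) : Prop :=
  (exists2 x, primal_feasible D (assortments N) x &
     primal_objective D (assortments N) x = V) /\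
  forall y, primal_feasible D (assortments N) y ->
    primal_objective D (assortments N) y <= V.

Definition eps_optimal (R : realFieldType) (L N K : nat)
    (D : network R L N K) (eps : R)
    (x : 'I_K -> {set option 'I_N} -> R) : Prop :=
  primal_feasible D (assortments N) x /\
  exists2 V, is_cdlp_value D V &
    (1 - eps) * V <= primal_objective D (assortments N) x.

(* \sum_(n in S, n > 0) P^k(n,S) [r_n - pi(l_n)] *)
Definition margin (R : realFieldType) (L N K : nat) (D : network R L N K)
    (pi : 'I_L -> R) (k : 'I_K) (S : {set option 'I_N}) : R :=
  \sum_(n < N | Some n \in S)
     choice_prob D k (Some n) S * (reward D n - pi (resource D n)).

Definition is_best_assortment (R : realFieldType) (L N K : nat)
    (D : network R L N K) (pi : 'I_L -> R) (k : 'I_K)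
    (S : {set option 'I_N}) : Prop :=
  S \in assortments N /\
  forall T, T \in assortments N -> margin D pi k T <= margin D pi k S.

(* What one iteration computes: the active collection H^d, the primal and dual
   solutions of the reduced program, and the assortments S_k^d. *)
Record iteration (R : realFieldType) (L N K : nat) := Iteration {
  active : {set {set option 'I_N}};
  primal : 'I_K -> {set option 'I_N} -> R;
  price : 'I_L -> R;
  dual_var : 'I_K -> R;
  column : 'I_K -> {set option 'I_N}
}.

Definition iteration_ok (R : realFieldType) (L N K : nat)
    (D : network R L N K) (eps : R) (it : iteration R L N K) : Prop :=
  [/\ primal_optimal D (active it) (primal it),
      dual_optimal D (active it) (price it) (dual_var it)
    & forall k : 'I_K, column it k \in assortments N /\
        exists2 Sstar, is_best_assortment D (price it) k Sstar &
          (1 - eps / (1 + eps)) * margin D (price it) k Sstar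
          <= margin D (price it) k (column it k)].

Definition reduced_profit (R : realFieldType) (L N K : nat)
    (D : network R L N K) (it : iteration R L N K) (k : 'I_K) : R :=
  arrival D k * margin D (price it) k (column it k) - dual_var it k.

Definition stops (R : realFieldType) (L N K : nat)
    (D : network R L N K) (it : iteration R L N K) : bool :=
  [forall k : 'I_K, reduced_profit D it k <= 0].

Definition next_active (R : realFieldType) (L N K : nat)
    (D : network R L N K) (it : iteration R L N K)
    (H' : {set {set option 'I_N}}) : Prop :=
  exists2 kstar : 'I_K,
    (forall k, reduced_profit D it k <= reduced_profit D it kstar) &
    H' = column it kstar |: active it.

(* An execution started from [H1]; [run 0] is the first iteration. Entries
   after the first iteration that stops are unconstrained padding. *)
Definition execution (R : realFieldType) (L N K : nat)
    (D : network R L N K) (eps : R) (H1 : {set {set option 'I_N}})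
    (run : nat -> iteration R L N K) : Prop :=
  active (run 0%N) = H1 /\
  forall d : nat, (forall e : nat, (e < d)%N -> ~~ stops D (run e)) ->
    iteration_ok D eps (run d) /\
    (~~ stops D (run d) -> next_active D (run d) (active (run d.+1))).

(* The primal solution of the iteration, extended by 0 outside its active
   collection. *)
Definition output (R : realFieldType) (L N K : nat) (it : iteration R L N K)
    (k : 'I_K) (S : {set option 'I_N}) : R :=
  if S \in active it then primal it k S else 0.

(* Main.v *)
Require Import Defs.
From HB Require Import structures.
From mathcomp Require Import all_boot all_order all_algebra.
From mathcomp Require Import ring lra.

Set Implicit Arguments.
Unset Strict Implicit.
Unset Printing Implicit Defensive.

Import Order.TTheory GRing.Theory Num.Theory.
Local Open Scope ring_scope.

(** Each iteration that does not stop adds a column with positive reduced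
    profit. Dual feasibility of the current prices makes the reduced profit of
    every active column nonpositive, so the active set grows strictly, and the
    algorithm stops.
    At termination let (pi, sigma) be the dual solution of the reduced program
    and W its value. The oracle guarantee turns
    Lambda_k margin(S_k^d) <= sigma(k) into
    Lambda_k margin(S) <= (1 + eps) sigma(k) for every assortment S, so
    (pi, (1 + eps) sigma) is dual feasible for the CDLP. Its value is at most
    (1 + eps) W since sum_j C_j pi(j) >= 0 (the capacities are nonnegative
    because the reduced program is feasible). Hence V <= (1 + eps) W, whence
    (1 - eps) V <= W, and W is the value of the output by strong duality.
    Strong duality rests on Farkas' lemma, proved by Fourier-Motzkin
    elimination, applied to the joint system
    A x <= b, y A >= c, y b <= c x. *)

(** * Farkas' lemma *)

Lemma solvable_dim1 (R : realFieldType) (I : finType) (a r : I -> R) :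
    (forall i, a i = 0 -> 0 <= r i) ->
    (forall p q, 0 < a p -> a q < 0 -> 0 <= a p * r q - a q * r p) ->
  exists t, forall i, a i * t <= r i.
Proof.
move=> h0 hpq.
case: (pickP [pred i | a i < 0]) => [q0 hq0|noneg].
  (* Rows with [a i < 0] bound [t] from below: take the largest lower bound, which [hpq] keeps below
     every upper bound. Without such rows, the smallest upper bound works. *)
  case: (@arg_maxP _ _ _ q0 [pred i | a i < 0] (fun i => r i / a i) hq0).
  move=> q /= aq_lt0 qmax; exists (r q / a q) => i.
  have [ai_gt0|ai_lt0|ai0] := ltrgt0P (a i); last by rewrite ai0 mul0r h0.
    rewrite mulrA ler_ndivrMr // -subr_ge0.
    have := hpq i q ai_gt0 aq_lt0; lra.
  by rewrite mulrC -ler_ndivrMr // qmax.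
case: (pickP [pred i | 0 < a i]) => [p0 hp0|nopos].
  case: (@arg_minP _ _ _ p0 [pred i | 0 < a i] (fun i => r i / a i) hp0).
  move=> p /= ap_gt0 pmin; exists (r p / a p) => i.
  have [ai_gt0|ai_lt0|ai0] := ltrgt0P (a i); last by rewrite ai0 mul0r h0.
    by rewrite mulrC -ler_pdivlMr // pmin.
  by have := noneg i; rewrite /= ai_lt0.
exists 0 => i; rewrite mulr0 h0 //.
have [ai_gt0|ai_lt0|//] := ltrgt0P (a i).
  by have := nopos i; rewrite /= ai_gt0.
by have := noneg i; rewrite /= ai_lt0.
Qed.

(* Row [(p, q)] of the Fourier-Motzkin elimination matrix for the column [a]:
   a positive and a negative row are combined so that [a] cancels, a row with
   [a p = 0] is kept, and the other pairs give the zero row. *)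
Definition fm_weight (R : realFieldType) (I : finType) (a : I -> R)
    (pq : I * I) (i : I) : R :=
  if (0 < a pq.1) && (a pq.2 < 0) then
    (i == pq.1)%:R * - a pq.2 + (i == pq.2)%:R * a pq.1
  else if a pq.1 == 0 then (i == pq.1)%:R else 0.

Lemma sum_deltaM (R : pzSemiRingType) (I : finType) (p : I) (f : I -> R) :
  \sum_i (i == p)%:R * f i = f p.
Proof.
rewrite (bigD1 p) //= eqxx mul1r big1 ?addr0 // => i /negPf ->.
by rewrite mul0r.
Qed.

Lemma sum_fm_weight (R : realFieldType) (I : finType) (a f : I -> R) pq :
  \sum_i fm_weight a pq i * f i =
  if (0 < a pq.1) && (a pq.2 < 0) then - a pq.2 * f pq.1 + a pq.1 * f pq.2
  else if a pq.1 == 0 then f pq.1 else 0.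
Proof.
rewrite /fm_weight; case: ifP => _.
  rewrite -(sum_deltaM pq.1 (fun i => - a pq.2 * f i)).
  rewrite -(sum_deltaM pq.2 (fun i => a pq.1 * f i)) -big_split /=.
  by apply: eq_bigr => i _; ring.
by case: ifP => _; [exact: sum_deltaM | rewrite big1 // => i _; rewrite mul0r].
Qed.

Lemma fm_weight_ge0 (R : realFieldType) (I : finType) (a : I -> R) pq i :
  0 <= fm_weight a pq i.
Proof.
rewrite /fm_weight; case: ifP => [/andP[ap aq]|_]; last by case: ifP.
by rewrite addr_ge0 // mulr_ge0 // ?oppr_ge0 ltW.
Qed.

(** Eliminating a column indexes the new rows by [I * I] but keeps the column type [J]. The
    induction is therefore on a set [E] containing all nonzero columns, with [I] generalized. *)
Lemma farkas (R : realFieldType) (J I : finType) (A : I -> J -> R)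
    (b : I -> R) :
  (exists x : J -> R, forall i, \sum_j A i j * x j <= b i) \/
  (exists y : I -> R, [/\ forall i, 0 <= y i,
     forall j, \sum_i y i * A i j = 0 & \sum_i y i * b i < 0]).
Proof.
have [E AE] : exists E : {set J}, forall i j, j \notin E -> A i j = 0.
  by exists [set: J] => i j; rewrite in_setT.
have [n] := ubnP #|E|; elim: n => // n IH in E I A b AE *.
rewrite ltnS => leEn.
have [E0|[j0 j0E]] := set_0Vmem E.
  have A0 i j : A i j = 0 by rewrite AE // E0 inE.
  case: (pickP [pred i | b i < 0]) => [i0 bi0|bge0].
    right; exists (fun i => (i == i0)%:R); split => [i|j|].
    - exact: ler0n.
    - by rewrite sum_deltaM A0.
    - by rewrite sum_deltaM.
  left; exists (fun=> 0) => i; rewrite big1 => [|j _]; last by rewrite mulr0.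
  by rewrite leNgt; apply/negbT/bge0.
pose W := fm_weight (A^~ j0).
pose A' pq j := \sum_i W pq i * A i j.
pose b' pq := \sum_i W pq i * b i.
have comb_sum (g : I * I -> R) (f : I -> R) :
    \sum_i (\sum_pq g pq * W pq i) * f i = \sum_pq g pq * \sum_i W pq i * f i.
  under eq_bigr => i _ do rewrite mulr_suml.
  rewrite exchange_big; apply: eq_bigr => pq _; rewrite mulr_sumr.
  by apply: eq_bigr => i _; rewrite mulrA.
have AE' pq j : j \notin E :\ j0 -> A' pq j = 0.
  rewrite inE negb_and negbK inE => /orP[/eqP ->|jE].
    rewrite /A' sum_fm_weight; case: ifP => [_|_]; first by ring.
    by case: ifP => // /eqP.
  by apply: big1 => i _; rewrite AE // mulr0.
have ltEn : (#|E :\ j0| < n)%N.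
  by apply: leq_trans leEn; rewrite [leqRHS](cardsD1 j0) j0E.
(* A certificate for the eliminated system pulls back through the nonnegative weights [W]. *)
have [[x hx]|[y [y0 yA yb]]] := IH _ _ A' b' AE' ltEn; last first.
  right; exists (fun i => \sum_pq y pq * W pq i); split => [i|j|].
  - by apply: sumr_ge0 => pq _; rewrite mulr_ge0 ?fm_weight_ge0.
  - by rewrite comb_sum yA.
  - by rewrite comb_sum.
(* [r] is the slack at [x], to be absorbed by moving coordinate [j0] by [t]. Row [(p, q)] of the
   eliminated system says that the bounds on [t] from rows [p] and [q] are compatible. *)
pose r i := b i - \sum_j A i j * x j.
have hr pq : 0 <= \sum_i W pq i * r i.
  have -> : \sum_i W pq i * r i = b' pq - \sum_j A' pq j * x j.
    under eq_bigr => i _ do rewrite mulrBr mulr_sumr.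
    rewrite sumrB exchange_big; congr (_ - _); apply: eq_bigr => j _.
    by rewrite mulr_suml; apply: eq_bigr => i _; rewrite mulrA.
  by rewrite subr_ge0 hx.
have [|p q ap aq|t ht] := @solvable_dim1 R I (A^~ j0) r.
- move=> i ai0; have := hr (i, i).
  by rewrite sum_fm_weight /= ai0 ltxx /= eqxx.
- have := hr (p, q); rewrite sum_fm_weight /= ap aq /=; lra.
left; exists (fun j => x j + (j == j0)%:R * t) => i.
have -> : \sum_j A i j * (x j + (j == j0)%:R * t) =
    \sum_j A i j * x j + A i j0 * t.
  rewrite -(sum_deltaM j0 (fun j => A i j * t)) -big_split /=.
  by apply: eq_bigr => j _; ring.
by rewrite addrC -lerBrDr.
Qed.

Lemma sum_option (V : nmodType) (T : finType) (P : pred (option T))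
    (F : option T -> V) :
  \sum_(o | P o) F o =
  (if P None then F None else 0) + \sum_(i | P (Some i)) F (Some i).
Proof.
rewrite big_mkcond (bigD1 None) //=; congr (_ + _).
rewrite (reindex_omap Some id) => [|[]//].
rewrite [RHS]big_mkcond; apply: eq_bigl => i.
by rewrite /= eqxx.
Qed.

(** The sign conditions become extra rows [- x j <= 0]; their multipliers are the values of [y A],
    hence [y A >= 0] in place of [y A = 0]. *)
Lemma farkas_nonneg (R : realFieldType) (J I : finType) (A : I -> J -> R)
    (b : I -> R) :
  (exists x : J -> R, (forall j, 0 <= x j) /\
     forall i, \sum_j A i j * x j <= b i) \/
  (exists y : I -> R, [/\ forall i, 0 <= y i,
     forall j, 0 <= \sum_i y i * A i j & \sum_i y i * b i < 0]).
Proof.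
pose A' (s : I + J) j := match s with inl i => A i j | inr j' => - (j == j')%:R end.
pose b' (s : I + J) := if s is inl i then b i else 0.
have [[x hx]|[y [y0 yA yb]]] := farkas A' b'.
  left; exists x; split=> [j|i]; last exact: hx (inl i).
  have := hx (inr j); rewrite /= -oppr_le0; congr (_ <= _).
  rewrite -(sum_deltaM j x) -sumrN.
  by apply: eq_bigr => j' _; rewrite mulNr.
right; exists (y \o inl); split=> [i|j|]; first exact: y0.
  have := yA j; rewrite big_sumType /= => /eqP.
  rewrite addr_eq0 => /eqP ->; rewrite -sumrN; apply: sumr_ge0 => j' _.
  by rewrite mulrN opprK mulr_ge0.
move: yb; rewrite big_sumType /= [X in _ + X]big1 ?addr0 // => j _.
by rewrite mulr0.
Qed.

(** * Duality for general linear programs *)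

Lemma lp_weak_duality (R : realFieldType) (J I : finType) (A : I -> J -> R)
    (b : I -> R) (c : J -> R) (x : J -> R) (y : I -> R) :
    (forall j, 0 <= x j) -> (forall i, \sum_j A i j * x j <= b i) ->
    (forall i, 0 <= y i) -> (forall j, c j <= \sum_i y i * A i j) ->
  \sum_j c j * x j <= \sum_i y i * b i.
Proof.
move=> x0 xb y0 yc.
apply: (@le_trans _ _ (\sum_j (\sum_i y i * A i j) * x j)).
  by apply: ler_sum => j _; exact: ler_wpM2r.
under eq_bigr => j _ do rewrite mulr_suml.
rewrite exchange_big; apply: ler_sum => i _.
under eq_bigr => j _ do rewrite -mulrA.
by rewrite -mulr_sumr ler_wpM2l.
Qed.

Lemma lp_strong_duality (R : realFieldType) (J I : finType) (A : I -> J -> R)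
    (b : I -> R) (c : J -> R) (x0 : J -> R) (y0 : I -> R) :
    (forall j, 0 <= x0 j) -> (forall i, \sum_j A i j * x0 j <= b i) ->
    (forall i, 0 <= y0 i) -> (forall j, c j <= \sum_i y0 i * A i j) ->
  exists x y,
    [/\ (forall j, 0 <= x j) /\ (forall i, \sum_j A i j * x j <= b i),
        (forall i, 0 <= y i) /\ (forall j, c j <= \sum_i y i * A i j)
      & \sum_i y i * b i <= \sum_j c j * x j].
Proof.
move=> x0_ge0 x0b y0_ge0 y0c.
(* [None] indexes the constraint [y b <= c x] of the joint system. *)
pose M (s : option (I + J)) (v : J + I) : R :=
  match s, v with
  | Some (inl i), inl j => A i j
  | Some (inr j), inr i => - A i j
  | None, inl j => - c j
  | None, inr i => b i
  | _, _ => 0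
  end.
pose q (s : option (I + J)) : R :=
  match s with
  | Some (inl i) => b i | Some (inr j) => - c j | None => 0
  end.
have [[z [z0 hz]]|[w [w0 wM wq]]] := farkas_nonneg M q.
  exists (z \o inl), (z \o inr); split; [split=> [j|i]|split=> [i|j]|] => /=;
      try exact: z0.
  - have := hz (Some (inl i)); rewrite big_sumType /=.
    by rewrite [X in _ + X]big1 ?addr0 // => i' _; rewrite mul0r.
  - have := hz (Some (inr j)); rewrite big_sumType /=.
    rewrite [X in X + _]big1 ?add0r; last by move=> i' _; rewrite mul0r.
    under eq_bigr => i _ do rewrite mulNr mulrC.
    by rewrite sumrN lerN2.
  - have := hz None; rewrite big_sumType /=.
    under eq_bigr => j _ do rewrite mulNr.
    under [X in _ + X]eq_bigr => i _ do rewrite mulrC.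
    by rewrite sumrN addrC subr_le0.
(* An infeasible joint system has multipliers [u], [v], [t] with [t c <= u A], [A v <= t b] and
   [u b < c v]. *)
exfalso.
pose u i := w (Some (inl i)); pose v j := w (Some (inr j)); pose t := w None.
have u0 i : 0 <= u i by exact: w0.
have v0 j : 0 <= v j by exact: w0.
have t0 : 0 <= t by exact: w0.
have wE (f : option (I + J) -> R) : \sum_s w s * f s =
    t * f None + (\sum_i u i * f (Some (inl i)) +
                  \sum_j v j * f (Some (inr j))).
  by rewrite sum_option /= big_sumType.
have uA j : t * c j <= \sum_i u i * A i j.
  have := wM (inl j); rewrite wE /= [X in _ + (_ + X)]big1.
    by rewrite addr0 mulrN addrC subr_ge0.
  by move=> j' _; rewrite mulr0.
have Av i : \sum_j A i j * v j <= t * b i.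
  have := wM (inr i); rewrite wE /= [X in _ + (X + _)]big1; last first.
    by move=> i' _; rewrite mulr0.
  under eq_bigr => j _ do rewrite mulrN mulrC.
  by rewrite add0r sumrN subr_ge0.
have ub_lt : \sum_i u i * b i < \sum_j c j * v j.
  move: wq; rewrite wE /= mulr0 add0r.
  under [X in _ + X]eq_bigr => j _ do rewrite mulrN mulrC.
  by rewrite sumrN subr_lt0.
(* For [t > 0], weak duality with data [t b] and [t c] gives [t (c v) <= t (u b)], a contradiction.
   For [t = 0], [u] and [v] are recession directions; pairing them with the feasible [x0] and [y0]
   gives [0 <= u b] and [c v <= 0]. *)
have [t_gt0|t_le0] := ltrP 0 t.
  have := lp_weak_duality v0 Av u0 uA; apply/negP; rewrite -ltNge.
  under eq_bigr => i _ do rewrite mulrCA.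
  under [ltRHS]eq_bigr => j _ do rewrite -mulrA.
  by rewrite -!mulr_sumr ltr_pM2l.
have {}t0 : t = 0 by apply/eqP; rewrite eq_le t_le0.
have ub0 : 0 <= \sum_i u i * b i.
  have uA0 j : 0 <= \sum_i u i * A i j by have := uA j; rewrite t0 mul0r.
  have := lp_weak_duality x0_ge0 x0b u0 uA0.
  by rewrite big1 // => j _; rewrite mul0r.
have cv0 : \sum_j c j * v j <= 0.
  have Av0 i : \sum_j A i j * v j <= 0 by have := Av i; rewrite t0 mul0r.
  have := lp_weak_duality v0 Av0 y0_ge0 y0c.
  by rewrite [leRHS]big1 // => i _; rewrite mulr0.
by have := le_lt_trans ub0 (lt_le_trans ub_lt cv0); rewrite ltxx.
Qed.

(** * The CDLP and its reduced programs as linear programs *)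

Section LinearProgram.
Variables (R : realFieldType) (L N K : nat) (D : network R L N K).
Implicit Types (j : 'I_L) (k : 'I_K) (S : {set option 'I_N}).
Implicit Types (H : {set {set option 'I_N}}) (x : 'I_K -> {set option 'I_N} -> R).

Definition revenue k S : R := \sum_(n in S) choice_prob D k n S * reward0 D n.

Definition consumption j k S : R :=
  \sum_(n < N | (resource D n == j) && (Some n \in S)) choice_prob D k (Some n) S.

Lemma consumption_ge0 j k S : S \in assortments N -> 0 <= consumption j k S.
Proof.
by move=> hS; apply: sumr_ge0 => n /andP[_ nS]; apply: choice_prob_ge0.
Qed.

(** Revenue is the capacity consumed, valued at prices [pi], plus the margin. This turns each dual
    constraint into a bound on the margin, the quantity the oracle approximates. *)
Lemma revenueE k S (pi : 'I_L -> R) :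
  revenue k S = \sum_j consumption j k S * pi j + margin D pi k S.
Proof.
have -> : \sum_j consumption j k S * pi j =
    \sum_(n < N | Some n \in S) choice_prob D k (Some n) S * pi (resource D n).
  under eq_bigr => j _ do rewrite mulr_suml big_mkcondl.
  rewrite exchange_big /=; apply: eq_bigr => n nS.
  by rewrite -big_mkcond (big_pred1 (resource D n)).
rewrite /revenue sum_option /= mulr0 if_same add0r /margin -big_split /=.
by apply: eq_bigr => n _; rewrite mulrBr addrC subrK.
Qed.

Lemma capacity_useE H x j :
  \sum_(k < K) arrival D k *
     (\sum_(n < N | resource D n == j)
        \sum_(S in H | Some n \in S) x k S * choice_prob D k (Some n) S) =
  \sum_k \sum_(S in H) arrival D k * consumption j k S * x k S.
Proof.
apply: eq_bigr => k _; under [RHS]eq_bigr => S _ do rewrite -mulrA.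
rewrite -mulr_sumr; congr (_ * _).
under eq_bigr => n _ do rewrite big_mkcondr.
rewrite exchange_big /=; apply: eq_bigr => S _.
rewrite -big_mkcondr /= mulr_suml.
by apply: eq_bigr => n _; rewrite mulrC.
Qed.

Lemma dual_useE k S (pi : 'I_L -> R) :
  \sum_(j < L) (arrival D k * (\sum_(n < N | (resource D n == j) && (Some n \in S))
     choice_prob D k (Some n) S)) * pi j =
  arrival D k * \sum_j consumption j k S * pi j.
Proof. by rewrite mulr_sumr; apply: eq_bigr => j _; rewrite mulrA. Qed.

Lemma dual_feasibleE H pi sigma :
  dual_feasible D H pi sigma <->
  [/\ forall j, 0 <= pi j, forall k, 0 <= sigma k
    & forall k S, S \in H -> arrival D k * margin D pi k S <= sigma k].
Proof.
have E k S : (arrival D k * (\sum_(n in S) choice_prob D k n S * reward0 D n)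
        <= \sum_(j < L)
             (arrival D k *
                (\sum_(n < N | (resource D n == j) && (Some n \in S))
                   choice_prob D k (Some n) S)) * pi j
           + sigma k) = (arrival D k * margin D pi k S <= sigma k).
  by rewrite dual_useE -/(revenue k S) (revenueE k S pi) mulrDr lerD2l.
by split=> -[pi0 sigma0 h]; split=> // k S hS; have := h k S hS; rewrite E.
Qed.

(* Variables outside [H] get zero columns, so that all the programs share one
   finite type of variables. *)
Let coeff H (i : 'I_L + 'I_K) (p : 'I_K * {set option 'I_N}) : R :=
  if p.2 \in H then
    match i with
    | inl j => arrival D p.1 * consumption j p.1 p.2
    | inr k => (p.1 == k)%:R
    end
  else 0.

Let bound (i : 'I_L + 'I_K) : R :=
  match i with inl j => capacity D j | inr _ => 1 end.

Let gain H (p : 'I_K * {set option 'I_N}) : R :=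
  if p.2 \in H then arrival D p.1 * revenue p.1 p.2 else 0.

Let sum_pairs H (F : 'I_K -> {set option 'I_N} -> R) :
  \sum_k \sum_(S in H) F k S = \sum_p if p.2 \in H then F p.1 p.2 else 0.
Proof.
rewrite -(pair_bigA _ (fun k S => if S \in H then F k S else 0)) /=.
by apply: eq_bigr => k _; rewrite big_mkcond.
Qed.

Let primal_objectiveE H x :
  primal_objective D H x = \sum_p gain H p * x p.1 p.2.
Proof.
rewrite /primal_objective sum_pairs; apply: eq_bigr => p _.
by rewrite /gain; case: ifP => _; rewrite ?mul0r // mulrAC.
Qed.

Let dual_objectiveE pi sigma :
  dual_objective D pi sigma =
  \sum_i (match i with inl j => pi j | inr k => sigma k end) * bound i.
Proof.
rewrite /dual_objective big_sumType /=; congr (_ + _); apply: eq_bigr => i _.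
  exact: mulrC.
by rewrite mulr1.
Qed.

Let primal_feasible_lp H x : (forall k S, 0 <= x k S) ->
  primal_feasible D H x <-> forall i, \sum_p coeff H i p * x p.1 p.2 <= bound i.
Proof.
move=> x0.
have El j : \sum_p coeff H (inl j) p * x p.1 p.2 =
    \sum_k \sum_(S in H) arrival D k * consumption j k S * x k S.
  rewrite sum_pairs; apply: eq_bigr => p _.
  by rewrite /coeff; case: ifP => // _; rewrite mul0r.
have Er k : \sum_p coeff H (inr k) p * x p.1 p.2 = \sum_(S in H) x k S.
  rewrite -(sum_deltaM k (fun k => \sum_(S in H) x k S)).
  under [RHS]eq_bigr => k' _ do rewrite mulr_sumr.
  rewrite sum_pairs; apply: eq_bigr => p _.
  by rewrite /coeff; case: ifP => // _; rewrite mul0r.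
split=> [[hC h1 _] [j|k]|h]; first by rewrite El -capacity_useE.
  by rewrite Er.
split=> // [j|k]; first by have := h (inl j); rewrite El -capacity_useE.
by have := h (inr k); rewrite Er.
Qed.

Let dual_feasible_lp H (y : 'I_L + 'I_K -> R) : (forall i, 0 <= y i) ->
  dual_feasible D H (y \o inl) (y \o inr) <->
  forall p, gain H p <= \sum_i y i * coeff H i p.
Proof.
move=> y0.
have E k S : S \in H -> \sum_i y i * coeff H i (k, S) =
    arrival D k * (\sum_j consumption j k S * y (inl j)) + y (inr k).
  move=> hS; rewrite big_sumType /coeff /= hS; congr (_ + _).
    by rewrite mulr_sumr; apply: eq_bigr => j _; ring.
  rewrite -[RHS](sum_deltaM k (y \o inr)); apply: eq_bigr => k' _.
  by rewrite mulrC eq_sym.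
split=> [[_ _ h] [k S]|h].
  (* For [S] outside [H] both gain and column vanish, so the constraint is trivial. *)
  rewrite /gain /=; case: ifP => hS; last first.
    by apply: sumr_ge0 => i _; rewrite /coeff /= hS mulr0.
  by have := h k S hS; rewrite E // dual_useE.
split=> [j|k|k S hS]; [exact: y0 | exact: y0 |].
by have := h (k, S); rewrite E // /gain hS dual_useE.
Qed.

(** Values of [x] outside [H] are arbitrary, possibly negative, while the general program wants
    every variable nonnegative; truncation reconciles the two. *)
Let primal_feasible_trunc H x : primal_feasible D H x ->
  let x' k S := if S \in H then x k S else 0 in
  (forall k S, 0 <= x' k S) /\ primal_feasible D H x'.
Proof.
move=> [hC h1 h0] x'.
have x'E k S : S \in H -> x' k S = x k S by rewrite /x' => ->.
split=> [k S|]; first by rewrite /x'; case: ifP => // /h0.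
split=> [j|k|k S hS]; last by rewrite x'E ?h0.
  have := hC j; rewrite !capacity_useE; congr (_ <= _).
  by apply: eq_bigr => k _; apply: eq_bigr => S hS; rewrite x'E.
by have := h1 k; congr (_ <= _); apply: eq_bigr => S hS; rewrite x'E.
Qed.

Lemma primal_objective_restrict H x :
  primal_objective D H (fun k S => if S \in H then x k S else 0) =
  primal_objective D H x.
Proof.
by apply: eq_bigr => k _; apply: eq_bigr => S ->.
Qed.

Let dual_lp H pi sigma : dual_feasible D H pi sigma ->
  let y i := match i with inl j => pi j | inr k => sigma k end in
  (forall i, 0 <= y i) /\ forall p, gain H p <= \sum_i y i * coeff H i p.
Proof.
move=> hd y; have y0 i : 0 <= y i by case: hd => pi0 s0 _; case: i.
by split=> //; apply/dual_feasible_lp.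
Qed.

Lemma cdlp_weak_duality H x pi sigma :
    primal_feasible D H x -> dual_feasible D H pi sigma ->
  primal_objective D H x <= dual_objective D pi sigma.
Proof.
move=> /primal_feasible_trunc[x0 hx] /dual_lp[y0 hy].
rewrite -primal_objective_restrict primal_objectiveE dual_objectiveE.
apply: (@lp_weak_duality _ _ _ (coeff H)) => //.
exact: (primal_feasible_lp H x0).1 hx.
Qed.

Lemma cdlp_strong_duality H x0 pi0 sigma0 :
    primal_feasible D H x0 -> dual_feasible D H pi0 sigma0 ->
  exists x pi sigma, [/\ primal_feasible D H x, dual_feasible D H pi sigma
    & dual_objective D pi sigma <= primal_objective D H x].
Proof.
move=> /primal_feasible_trunc[x0_ge0 hx0] /dual_lp[y0_ge0 hy0].
have [x [y [[x_ge0 hx] [y_ge0 hy] hxy]]] :=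
  lp_strong_duality (fun p => x0_ge0 p.1 p.2)
    ((primal_feasible_lp H x0_ge0).1 hx0) y0_ge0 hy0.
exists (fun k S => x (k, S)), (y \o inl), (y \o inr); split.
- apply/primal_feasible_lp => // i; apply: le_trans (hx i).
  by apply: ler_sum => -[].
- exact/dual_feasible_lp.
- rewrite primal_objectiveE dual_objectiveE.
  rewrite [leRHS](_ : _ = \sum_p gain H p * x p); last by apply: eq_bigr => -[].
  by rewrite [leLHS](_ : _ = \sum_i y i * bound i) //; apply: eq_bigr => -[].
Qed.

(** Strong duality supplies some pair without gap, not the given one; each given solution is
    compared with its half of that pair. *)
Lemma optimal_values_eq H x pi sigma :
    primal_optimal D H x -> dual_optimal D H pi sigma ->
  primal_objective D H x = dual_objective D pi sigma.
Proof.
move=> [hx xmax] [hd dmin]; apply/eqP; rewrite eq_le cdlp_weak_duality //=.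
have [x' [pi' [sigma' [hx' hd' le']]]] := cdlp_strong_duality hx hd.
exact: le_trans (dmin _ _ hd') (le_trans le' (xmax _ hx')).
Qed.

Lemma cdlp_value_exists x pi sigma :
    primal_feasible D (assortments N) x ->
    dual_feasible D (assortments N) pi sigma ->
  exists V, is_cdlp_value D V.
Proof.
move=> hx hd; have [x' [pi' [sigma' [hx' hd' le']]]] := cdlp_strong_duality hx hd.
exists (primal_objective D (assortments N) x'); split; first by exists x'.
by move=> y hy; apply: le_trans le'; apply: cdlp_weak_duality.
Qed.

(** * The guarantee at termination *)

Lemma capacity_ge0 H x j : H \subset assortments N ->
  primal_feasible D H x -> 0 <= capacity D j.
Proof.
move=> /subsetP hH [hC _ x0]; apply: le_trans (hC j); rewrite capacity_useE.
apply: sumr_ge0 => k _; apply: sumr_ge0 => S hS.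
by rewrite !mulr_ge0 ?arrival_ge0 ?consumption_ge0 ?x0 ?hH.
Qed.

Lemma sum_extend0 H (F : {set option 'I_N} -> R) : H \subset assortments N ->
    (forall S, S \notin H -> F S = 0) ->
  \sum_(S in assortments N) F S = \sum_(S in H) F S.
Proof.
move=> hH F0; rewrite (big_setID H) /= (setIidPr hH) [X in _ + X]big1 ?addr0 //.
by move=> S /setDP[_ /F0].
Qed.

Lemma output_objective (it : iteration R L N K) :
    active it \subset assortments N ->
  primal_objective D (assortments N) (output it) =
  primal_objective D (active it) (primal it).
Proof.
move=> hH; apply: eq_bigr => k _; rewrite (sum_extend0 hH) => [|S /negPf nS].
  by apply: eq_bigr => S hS; rewrite /output hS.
by rewrite /output nS mulr0 mul0r.
Qed.

Lemma output_feasible (it : iteration R L N K) :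
    active it \subset assortments N ->
    primal_feasible D (active it) (primal it) ->
  primal_feasible D (assortments N) (output it).
Proof.
move=> hH [hC h1 h0]; split=> [j|k|k S _].
- have := hC j; rewrite !capacity_useE; congr (_ <= _); apply: eq_bigr => k _.
  rewrite (sum_extend0 hH) => [|S /negPf nS]; last by rewrite /output nS mulr0.
  by apply: eq_bigr => S hS; rewrite /output hS.
- have := h1 k; rewrite (sum_extend0 hH) => [|S /negPf nS].
    by congr (_ <= _); apply: eq_bigr => S hS; rewrite /output hS.
  by rewrite /output nS.
- by rewrite /output; case: ifP => // /h0.
Qed.

Lemma scaled_dual_feasible eps (it : iteration R L N K) :
    0 < eps -> iteration_ok D eps it -> stops D it ->
  dual_feasible D (assortments N) (price it)
    (fun k => (1 + eps) * dual_var it k).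
Proof.
move=> eps0 [_ [[pi0 s0 _] _] hcol] /forallP hstop.
have e1 : 0 < 1 + eps by rewrite addr_gt0.
apply/dual_feasibleE; split=> // [k|k S hS]; first by rewrite mulr_ge0 // ltW.
have [_ [T [_ Tbest] Tcol]] := hcol k.
have := hstop k; rewrite subr_le0 => hk.
apply: le_trans (ler_wpM2l (ltW e1) hk); rewrite mulrCA.
apply: ler_wpM2l; first exact: arrival_ge0.
(* The oracle factor [1 - eps / (1 + eps)] equals [1 / (1 + eps)]. *)
apply: le_trans (Tbest S hS) _; rewrite mulrC -ler_pdivrMr // mulrC.
apply: le_trans Tcol; rewrite le_eqVlt; apply/orP; left; apply/eqP.
by congr (_ * _); field; rewrite gt_eqF.
Qed.

Lemma stop_eps_optimal eps (it : iteration R L N K) :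
    0 < eps -> active it \subset assortments N ->
    iteration_ok D eps it -> stops D it ->
  eps_optimal D eps (output it).
Proof.
move=> eps0 hH hok hstop; have [popt dopt _] := hok.
have hx := output_feasible hH popt.1.
have hd := scaled_dual_feasible eps0 hok hstop.
split=> //; have [V hV] := cdlp_value_exists hx hd; exists V => //.
rewrite output_objective // (optimal_values_eq popt dopt).
have [[pi0 s0 _] _] := dopt.
have C0 : 0 <= \sum_(j < L) capacity D j * price it j.
  by apply: sumr_ge0 => j _; rewrite mulr_ge0 // (capacity_ge0 _ hH popt.1).
have S0 : 0 <= \sum_(k < K) dual_var it k by exact: sumr_ge0.
have V0 : 0 <= V.
  apply: le_trans (hV.2 _ hx); rewrite output_objective //.
  by rewrite (optimal_values_eq popt dopt) addr_ge0.
have leV : V <= \sum_(j < L) capacity D j * price it j +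
                (1 + eps) * \sum_(k < K) dual_var it k.
  by have [[y hy <-] _] := hV; rewrite mulr_sumr; apply: cdlp_weak_duality hy hd.
(* With [W] the right-hand side, [(1 - eps) (1 + eps) V <= V <= (1 + eps) W], the first step by
   [V0]; divide by [1 + eps]. This covers [eps > 1] too. *)
rewrite /dual_objective; nra.
Qed.

(** * Finite termination *)

Lemma next_active_proper eps (it : iteration R L N K) H' :
    iteration_ok D eps it -> ~~ stops D it -> next_active D it H' ->
  exists2 S, S \in assortments N & (S \notin active it) && (H' == S |: active it).
Proof.
move=> [_ [/dual_feasibleE[_ _ hd] _] hcol] /forallPn[k nk] [k' k'max ->].
exists (column it k'); first by case: (hcol k').
rewrite eqxx andbT; apply: contra nk => /(hd k') le0.
by apply: le_trans (k'max k) _; rewrite subr_le0.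
Qed.

Lemma active_grows eps H1 (run : nat -> iteration R L N K) :
    H1 \subset assortments N -> execution D eps H1 run ->
  forall d, (forall e, (e < d)%N -> ~~ stops D (run e)) ->
    active (run d) \subset assortments N /\ (d <= #|active (run d)|)%N.
Proof.
move=> hH1 [run0 hrun]; elim=> [|d IH] hns; first by rewrite run0.
have hns' e : (e < d)%N -> ~~ stops D (run e).
  by move=> lt_ed; apply: hns; apply: ltnW.
have [sub_d card_d] := IH hns'; have [hok hnext] := hrun d hns'.
have nd := hns d (leqnn _).
have [S hS /andP[nS /eqP ->]] := next_active_proper hok nd (hnext nd).
by rewrite subUset sub1set hS sub_d cardsU1 nS.
Qed.

End LinearProgram.

Theorem theorem2 (R : realFieldType) (L N K : nat) (D : network R L N K)
    (eps : R) (heps : 0 < eps)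
    (H1 : {set {set option 'I_N}}) (hH1 : H1 \subset assortments N)
    (run : nat -> iteration R L N K) (hrun : execution D eps H1 run) :
  exists d : nat,
    [/\ forall e : nat, (e < d)%N -> ~~ stops D (run e),
        stops D (run d)
      & eps_optimal D eps (output (run d))].
Proof.
have grows := active_grows hH1 hrun.
have exd : exists d, stops D (run d).
  pose M := #|assortments N|.
  case: (boolP [exists d : 'I_M.+1, stops D (run d)]) => [/existsP[d hd]|].
    by exists d.
  (* If iterations [0] to [M] all continue, the active set at [M.+1] has more than [M]
     assortments. *)
  move=> /existsPn nstops; have [e lt_eM|sub_M] := grows M.+1.
    exact: nstops (Ordinal lt_eM).
  by rewrite leqNgt ltnS subset_leq_card.
(* An execution is constrained only up to its first stop, so the least stopping index is taken. *)
case: (ex_minnP exd) => d hd dmin.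
have hns e : (e < d)%N -> ~~ stops D (run e).
  by rewrite ltnNge; apply: contra => /dmin.
exists d; split=> //.
have [sub_d _] := grows d hns; have [hok _] := hrun.2 d hns.
exact: stop_eps_optimal.
Qed.
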